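(* Let $n\ge2$, and for $\alpha,\gamma\in\mathbb R$ define on $\{z\in\mathbb C^n:0<|z|<1\}$ $$u_{\alpha,\gamma}(z)=-|z|^{-2\alpha}\bigl(-\log|z|^2\bigr)^{-\gamma}.$$ If $\alpha>0$ and $p>0$, then $u_{\alpha,\gamma}\in L^p_{\mathrm{loc}}$ near the origin if and only if either $p<n/\alpha$, or $p=n/\alpha$ and $\gamma p>1$. If $\alpha\le0$, then $u_{\alpha,\gamma}\in L^p_{\mathrm{loc}}$ near the origin for every $p>0$.
   Context: ''$u\in L^p_{\mathrm{loc}}$ near the origin'' means that $|u|^p$ is Lebesgue integrable on some ball $\{|z|<\varepsilon\}$, $\varepsilon>0$, in $\mathbb C^n$ (the value at the single point $0$ is irrelevant). *)

(* Defs.v *)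
From HB Require Import structures.
From mathcomp Require Import all_boot all_order all_algebra.
From mathcomp Require Import complex.
From mathcomp Require Import all_classical all_reals all_analysis.

Set Implicit Arguments.
Unset Strict Implicit.
Unset Printing Implicit Defensive.

Import Order.TTheory GRing.Theory Num.Theory.
Import numFieldNormedType.Exports.

Local Open Scope classical_set_scope.
Local Open Scope ring_scope.

Lemma sigma_finite_pushforward d1 d2 (T1 : measurableType d1)
    (T2 : measurableType d2) (R : realType) (m : {measure set T1 -> \bar R})
    (f : T1 -> T2) (g : T2 -> T1) :
  measurable_fun setT g -> cancel f g ->
  sigma_finite setT m -> sigma_finite setT (pushforward m f).
Proof.
move=> mg fK [F TF mF]; exists (fun i => g @^-1` F i).
  by rewrite -preimage_bigcup -TF preimage_setT.
move=> i; have [mFi Fi] := mF i; split.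
  by rewrite -[X in measurable X]setTI; exact: mg.
rewrite /pushforward -comp_preimage.
by rewrite (_ : g \o f = id)// funeqE => x /=; rewrite fK.
Qed.

(* The library's instance of this fact is shadowed by the one for products of
   subprobabilities and is not found by unification. *)
Lemma sigma_finite_product_measure1 d1 d2 (T1 : measurableType d1)
    (T2 : measurableType d2) (R : realType)
    (m1 : {sigma_finite_measure set T1 -> \bar R})
    (m2 : {sigma_finite_measure set T2 -> \bar R}) :
  sigma_finite setT (m1 \x m2)%E.
Proof.
have /sigma_finiteP[F [TF ndF Foo]] := sigma_finiteT m1.
have /sigma_finiteP[G [TG ndG Goo]] := sigma_finiteT m2.
exists (fun n => F n `*` G n).
  rewrite -setXTT TF TG predeqE => -[x y]; split.
    move=> [/= [n _ Fnx] [k _ Gky]]; exists (maxn n k) => //; split.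
    - by move: x Fnx; exact/subsetPset/ndF/leq_maxl.
    - by move: y Gky; exact/subsetPset/ndG/leq_maxr.
  by move=> [n _ []/= ? ?]; split; exists n.
move=> k; have [? ?] := Foo k; have [? ?] := Goo k.
split; first exact: measurableX.
by rewrite product_measure1E// lte_mul_pinfty// ge0_fin_numE.
Qed.

Section complex_measurable.
Variable R : realType.

Definition complex_of_pair (xy : measurableTypeR R * measurableTypeR R) : R[i] :=
  Complex xy.1 xy.2.

Definition pair_of_complex (z : R[i]) : measurableTypeR R * measurableTypeR R :=
  (complex.Re z, complex.Im z).

Lemma complex_of_pairK : cancel complex_of_pair pair_of_complex.
Proof. by case. Qed.

Lemma pair_of_complexK : cancel pair_of_complex complex_of_pair.
Proof. by case. Qed.

HB.instance Definition _ := isPointed.Build R[i] 0.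

(* The Borel sigma-algebra of C, transported from R * R. *)
Definition measurable_complex : set (set R[i]) :=
  [set A | measurable (complex_of_pair @^-1` A)].

Let measurable_complex0 : measurable_complex set0.
Proof. by rewrite /measurable_complex/= preimage_set0; exact: measurable0. Qed.

Let measurable_complexC A : measurable_complex A -> measurable_complex (~` A).
Proof.
by rewrite /measurable_complex/= -preimage_setC; exact: measurableC.
Qed.

Let measurable_complex_bigcup (F : (set R[i])^nat) :
  (forall i, measurable_complex (F i)) -> measurable_complex (\bigcup_i F i).
Proof.
rewrite /measurable_complex/= => mF; rewrite preimage_bigcup.
exact: bigcup_measurable.
Qed.

HB.instance Definition _ := @isMeasurable.Build default_measure_display R[i]
  measurable_complex measurable_complex0 measurable_complexC
  measurable_complex_bigcup.

Lemma measurable_complex_of_pair : measurable_fun setT complex_of_pair.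
Proof. by move=> _ A mA; rewrite setTI. Qed.

Lemma measurable_pair_of_complex : measurable_fun setT pair_of_complex.
Proof.
move=> _ A mA; rewrite setTI /measurable/= /measurable_complex/=.
by rewrite -comp_preimage (_ : _ \o _ = id)// funeqE => x; exact: complex_of_pairK.
Qed.

(* Lebesgue measure dx dy on C. *)
Definition lebesgue_complex : set R[i] -> \bar R :=
  pushforward (@lebesgue_measure R \x @lebesgue_measure R)%E complex_of_pair.

Let P : {measure set R[i] -> \bar R} :=
  measure_function_pushforward__canonical__measure_function_Measure
    (@lebesgue_measure R \x @lebesgue_measure R)%E measurable_complex_of_pair.

Let lebesgue_complex0 : lebesgue_complex set0 = 0%E.
Proof. exact: (measure0 P). Qed.

Let lebesgue_complex_ge0 A : (0 <= lebesgue_complex A)%E.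
Proof. exact: (measure_ge0 P). Qed.

Let lebesgue_complex_sigma_additive : semi_sigma_additive lebesgue_complex.
Proof. exact: (@measure_semi_sigma_additive _ _ _ P). Qed.

HB.instance Definition _ := isMeasure.Build _ _ _ lebesgue_complex
  lebesgue_complex0 lebesgue_complex_ge0 lebesgue_complex_sigma_additive.

Let lebesgue_complex_sigma_finite : sigma_finite setT lebesgue_complex.
Proof.
apply: (sigma_finite_pushforward measurable_pair_of_complex complex_of_pairK).
exact: sigma_finite_product_measure1.
Qed.

HB.instance Definition _ := Measure_isSigmaFinite.Build _ _ _ lebesgue_complex
  lebesgue_complex_sigma_finite.

End complex_measurable.

Section cons_measure.
Local Open Scope ereal_scope.
Context d (T : measurableType d) (R : realType) (n : nat).
Variable m1 : {sigma_finite_measure set T -> \bar R}.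
Variable m2 : {sigma_finite_measure set n.-tuple T -> \bar R}.

Definition cons_pair (x : T * n.-tuple T) : n.+1.-tuple T :=
  [tuple of x.1 :: x.2].

Definition uncons_tuple (z : n.+1.-tuple T) : T * n.-tuple T :=
  (thead z, [tuple of behead z]).

Lemma cons_pairK : cancel cons_pair uncons_tuple.
Proof.
move=> [x z]; rewrite /uncons_tuple; congr (_, _).
exact/val_inj.
Qed.

Lemma measurable_cons_pair : measurable_fun setT cons_pair.
Proof. exact: measurable_cons. Qed.

Lemma measurable_uncons_tuple : measurable_fun setT uncons_tuple.
Proof.
apply/measurable_fun_pair; first exact: (@measurable_tnth _ T n.+1 ord0).
exact: measurable_behead.
Qed.

(* The product measure m1 x m2, carried over to (n+1)-tuples. *)
Definition cons_measure : set (n.+1.-tuple T) -> \bar R :=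
  pushforward (m1 \x m2) cons_pair.

Let P : {measure set n.+1.-tuple T -> \bar R} :=
  measure_function_pushforward__canonical__measure_function_Measure
    (m1 \x m2) measurable_cons_pair.

Let cons_measure0 : cons_measure set0 = 0.
Proof. exact: (measure0 P). Qed.

Let cons_measure_ge0 A : 0 <= cons_measure A.
Proof. exact: (measure_ge0 P). Qed.

Let cons_measure_sigma_additive : semi_sigma_additive cons_measure.
Proof. exact: (@measure_semi_sigma_additive _ _ _ P). Qed.

HB.instance Definition _ := isMeasure.Build _ _ _ cons_measure
  cons_measure0 cons_measure_ge0 cons_measure_sigma_additive.

Let cons_measure_sigma_finite : sigma_finite setT cons_measure.
Proof.
apply: (sigma_finite_pushforward measurable_uncons_tuple cons_pairK).
exact: sigma_finite_product_measure1.
Qed.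

HB.instance Definition _ := Measure_isSigmaFinite.Build _ _ _ cons_measure
  cons_measure_sigma_finite.

End cons_measure.

Fixpoint lebesgue_Cn (R : realType) (n : nat) :
    {sigma_finite_measure set n.-tuple R[i] -> \bar R} :=
  match n with
  | 0 => \d_([tuple] : 0.-tuple R[i])
  | n'.+1 => cons_measure (@lebesgue_complex R) (lebesgue_Cn R n')
  end.

Lemma lebesgue_complex_rect (R : realType) (A B : set (measurableTypeR R)) :
  measurable A -> measurable B ->
  lebesgue_complex [set z : R[i] | A (complex.Re z) /\ B (complex.Im z)] =
  (@lebesgue_measure R A * @lebesgue_measure R B)%E.
Proof. by move=> mA mB; rewrite -product_measure1E. Qed.

Lemma lebesgue_Cn_box (R : realType) (n : nat) (A : 'I_n -> set R[i]) :
  (forall j, measurable (A j)) ->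
  lebesgue_Cn R n [set z | forall j, A j (tnth z j)] =
  (\prod_(j < n) lebesgue_complex (A j))%E.
Proof.
elim: n A => [|n IHn] A mA.
  rewrite big_ord0 /= diracE mem_set//; by case.
rewrite big_ord_recl -IHn//= -product_measure1E//=; last first.
  rewrite (_ : [set z | _] = \bigcap_(j in [set: 'I_n])
      ((@tnth n R[i])^~ j @^-1` A (lift ord0 j))).
    apply: fin_bigcap_measurable => // j _.
    by rewrite -[X in measurable X]setTI; exact: measurable_tnth.
  by apply/seteqP; split => z /= + j; [move=> /(_ j)|move=> /(_ j I)].
rewrite /cons_measure /pushforward; congr (_ _); apply/seteqP; split.
- move=> [x z] /= xz; split; first exact: (xz ord0).
  by move=> j; have := xz (lift ord0 j); rewrite tnthS.
- move=> [x z] /= [Ax Az] j; have [j'|->] := unliftP ord0 j => [->|//].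
  by rewrite tnthS.
Qed.

Definition normCn (R : realType) (n : nat) (z : n.-tuple R[i]) : R :=
  Num.sqrt (\sum_(j < n) Normc.normc (tnth z j) ^+ 2).

(* Only meaningful for 0 < |z| < 1; elsewhere [ln] and [powR] take (finite)
   default values. *)
Definition u_fun (R : realType) (n : nat) (alpha gamma : R)
    (z : n.-tuple R[i]) : R :=
  - (normCn z `^ (- 2 * alpha) * (- ln (normCn z ^+ 2)) `^ (- gamma)).

(* Integrability on a ball passes to smaller balls, and {0} is a null set, so
   for a function given on a punctured ball 0 < |z| < r only, neither the value
   at 0 nor the values for |z| >= r matter.  Measurability is with respect to the Borel
   sets, as for [lebesgue_measure] on R; for Borel functions this agrees with
   integrability for the completed measure. *)
Definition Lp_loc0 (R : realType) (n : nat) (p : R)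
    (u : n.-tuple R[i] -> R) : Prop :=
  exists2 eps : R, 0 < eps &
    (lebesgue_Cn R n).-integrable [set z | normCn z < eps]
      (fun z => (`|u z| `^ p)%:E).

(* Main.v *)
Require Import Defs.
From mathcomp Require Import all_boot all_order all_algebra.
From mathcomp Require Import complex.
From mathcomp Require Import all_classical all_reals all_analysis.
From mathcomp Require Import measurable_realfun.
From mathcomp Require Import ring lra.

(* Put L = - log |z|^2.  For 0 < |z| < 1 one has
   |u|^p = e^(alpha p L) L^(- gamma p) = e^(n L) g(L),  where
   g(L) = e^((alpha p - n) L) L^(- gamma p).  The shell k <= L < k + 1 has
   volume comparable to e^(- n k): it lies in a cube of side 2 e^(- k / 2) and
   contains a cube whose side is a fixed multiple of e^(- k / 2).  The integral
   of |u|^p over it is therefore at most C k^(- s) as soon as g(L) <= C L^(- s),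
   and at least c / (k + 1) as soon as g(L) >= c / L.  The first bound holds for
   some s > 1 if alpha p < n, or alpha p = n and gamma p > 1; the second one
   holds in all other cases, and the harmonic series diverges. *)

Set Implicit Arguments.
Unset Strict Implicit.
Unset Printing Implicit Defensive.

Import Order.TTheory GRing.Theory Num.Theory.
Import numFieldNormedType.Exports.

Local Open Scope classical_set_scope.
Local Open Scope ring_scope.

(** * Powers against exponentials, and two series *)

Section real_analysis.
Context {R : realType}.
Implicit Types b q s t x : R.

(** Round the exponent up to the integer m + 1 > |q|; a single term (b x)^(m+1) / (m+1)! of the
    exponential series is then enough. *)
Lemma powR_le_expR b q : 0 < b ->
  exists2 C, 0 < C & forall x, 1 <= x -> x `^ q <= C * expR (b * x).
Proof.
move=> b0; pose m := Num.trunc `|q|.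
exists (m.+1`!%:R / b ^+ m.+1) => [|x x1].
  by rewrite divr_gt0 ?exprn_gt0// ltr0n fact_gt0.
have x0 : 0 <= x by rewrite (le_trans ler01).
have qm : x `^ q <= x ^+ m.+1.
  rewrite -powR_mulrn//; apply: ler_powR => //.
  by rewrite (le_trans (ler_norm q))// ltW// truncnS_gt.
apply: (le_trans qm).
have H : (b * x) ^+ m.+1 / m.+1`!%:R <= expR (b * x).
  by apply: le_trans (expR_ge1Dxn m (mulr_ge0 (ltW b0) x0)); rewrite lerDr.
move: H; rewrite exprMn ler_pdivrMr ?ltr0n ?fact_gt0// => H.
by rewrite mulrAC ler_pdivlMr ?exprn_gt0// mulrC [leRHS]mulrC.
Qed.

(** If b < 0, exponential decay absorbs the factor x^(2 - t), so s = 2 works; if b = 0, s = t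
    works. *)
Lemma expR_powR_le_powR b t : b < 0 \/ (b = 0 /\ 1 < t) ->
  exists s C, [/\ 1 < s, 0 < C &
    forall x, 1 <= x -> expR (b * x) * x `^ (- t) <= C * x `^ (- s)].
Proof.
move=> [b0|[-> t1]]; last first.
  by exists t, 1; split => // x _; rewrite mul0r expR0.
have [|C C0 HC] := @powR_le_expR (- b) (2 - t); first by rewrite oppr_gt0.
exists 2, C; split => //; first by rewrite ltr1n.
move=> x x1; have x0 : 0 < x by rewrite (lt_le_trans ltr01).
have xn0 : (x != 0) by rewrite gt_eqF.
have := HC _ x1; rewrite powRD ?xn0 ?implybT// mulNr expRN.
rewrite ler_pdivlMr ?expR_gt0// => H.
rewrite (powRN _ 2) ler_pdivlMr ?powR_gt0//; apply: le_trans H.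
by rewrite le_eqVlt; apply/orP; left; apply/eqP; ring.
Qed.

(** If b > 0, the growth of e^(b x) dominates x^(t - 1); if b = 0, x^(- t) >= x^(- 1) because t <=
    1. *)
Lemma expR_powR_ge_inv b t : 0 < b \/ (b = 0 /\ t <= 1) ->
  exists2 c, 0 < c &
    forall x, 1 <= x -> c / x <= expR (b * x) * x `^ (- t).
Proof.
move=> [b0|[-> t1]]; last first.
  exists 1 => // x x1; have x0 : 0 < x by rewrite (lt_le_trans ltr01).
  rewrite mul0r expR0 !mul1r -powR_inv1 ?(ltW x0)//.
  by rewrite ler_powR// lerN2.
have [C C0 HC] := @powR_le_expR b (t - 1) b0.
exists C^-1; first by rewrite invr_gt0.
move=> x x1; have x0 : 0 < x by rewrite (lt_le_trans ltr01).
have xn0 : (x != 0) by rewrite gt_eqF.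
have := HC _ x1; rewrite powRD ?xn0 ?implybT// powR_inv1 ?(ltW x0)//.
rewrite -ler_pdivrMl// => H.
rewrite powRN ler_pdivlMr ?powR_gt0//.
by rewrite mulrAC -mulrA.
Qed.

(* Cauchy condensation: the block [2^m <= k < 2^(m+1)] contributes at most
   [(2^(1-s))^m]. *)
Lemma sum_powR_bounded s : 1 < s ->
  exists M, forall N, \sum_(0 <= k < N) k%:R `^ (- s) <= M.
Proof.
move=> s1; pose q : R := 2 * 2 `^ (- s).
have q0 : 0 < q by rewrite mulr_gt0 ?powR_gt0.
have q1 : 0 < 1 - q.
  rewrite subr_gt0 /q powRN ltr_pdivrMr ?powR_gt0// mul1r.
  by rewrite -[ltLHS]lnK ?posrE// /powR gt_eqF// ltr_expR ltr_pMl// ln_gt0 ?ltr1n.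
have block m : (1 - q) * \sum_(0 <= k < 2 ^ m) k%:R `^ (- s) <= 1 - q ^+ m.
  elim: m => [|m IH].
    rewrite expn0 big_nat1 powR0 ?mulr0 ?expr0 ?subrr// oppr_eq0.
    by rewrite gt_eqF// (lt_trans ltr01).
  rewrite (@big_cat_nat _ _ _ (2 ^ m))//=; last by rewrite leq_exp2l.
  rewrite mulrDr exprS.
  rewrite (_ : 1 - q * q ^+ m = (1 - q ^+ m) + (1 - q) * q ^+ m); last by ring.
  rewrite lerD// ler_pM2l//.
  have -> : q ^+ m = \sum_(2 ^ m <= k < 2 ^ m.+1) (2 ^ m)%:R `^ (- s).
    rewrite sumr_const_nat expnS mul2n -addnn addnK /q exprMn natrX.
    rewrite -[RHS]mulr_natl natrX; congr (_ * _).
    by rewrite -(powR_mulrn m (powR_ge0 _ _)) -powRrM mulrC powRrM powR_mulrn.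
  rewrite big_nat_cond [leRHS]big_nat_cond; apply: ler_sum => k.
  rewrite andbT => /andP[mk _]; rewrite !powRN.
  rewrite lef_pV2 ?posrE ?powR_gt0 ?ltr0n ?expn_gt0//.
    by rewrite ge0_ler_powR ?nnegrE ?ler0n ?ler_nat// (le_trans ler01)// ltW.
  by rewrite (leq_trans _ mk)// expn_gt0.
exists (1 - q)^-1 => N; rewrite -[leRHS]mulr1 ler_pdivlMl//.
apply: le_trans (le_trans (block N) _); last first.
  by rewrite gerBl exprn_ge0// ltW.
rewrite ler_pM2l// (@big_cat_nat _ _ _ N 0 (2 ^ N))//=; last first.
  by rewrite ltnW// ltn_expl.
by rewrite lerDl sumr_ge0// => k _; rewrite powR_ge0.
Qed.

(** A bound on the sums from [k0] on would bound all partial sums, and the nondecreasing harmonic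
    series would converge. *)
Lemma sum_harmonic_unbounded (k0 : nat) (M : R) :
  exists N, M < \sum_(k0 <= k < N) k.+1%:R^-1.
Proof.
apply: contrapT => /forallNP H; apply: (@dvg_harmonic R).
apply: nondecreasing_is_cvgn.
  apply: nondecreasing_series => k _ _; exact: harmonic_ge0.
exists (M + \sum_(0 <= k < k0) k.+1%:R^-1) => _ [N _ <-]; rewrite seriesEnat.
have [Nk|kN] := leqP N k0; last first.
  rewrite /= (@big_cat_nat _ _ _ k0)//= 1?ltnW// addrC lerD2r.
  by rewrite leNgt; apply/negP/H.
have M0 : 0 <= M by have /negP := H k0; rewrite -leNgt big_geq.
rewrite /= [X in _ + X](@big_cat_nat _ _ _ N)//= addrCA lerDl.
by rewrite addr_ge0// sumr_ge0.
Qed.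

End real_analysis.

(** * Volumes of balls and annuli, by comparison with cubes *)

Section balls_and_boxes.
Context {R : realType}.
Implicit Types n : nat.

Lemma normCn_ge0 n (z : n.-tuple R[i]) : 0 <= normCn z.
Proof. exact: sqrtr_ge0. Qed.

Lemma sqr_normc (z : R[i]) :
  Normc.normc z ^+ 2 = complex.Re z ^+ 2 + complex.Im z ^+ 2.
Proof. by case: z => x y /=; rewrite sqr_sqrtr// addr_ge0 ?sqr_ge0. Qed.

Lemma sqr_normCn n (z : n.-tuple R[i]) : normCn z ^+ 2 =
  \sum_(j < n) (complex.Re (tnth z j) ^+ 2 + complex.Im (tnth z j) ^+ 2).
Proof.
rewrite sqr_sqrtr; last by apply: sumr_ge0 => j _; exact: sqr_ge0.
by apply: eq_bigr => j _; rewrite sqr_normc.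
Qed.

Lemma measurable_Re : measurable_fun setT (fun z : R[i] => complex.Re z).
Proof. exact: measurableT_comp measurable_fst (@measurable_pair_of_complex R). Qed.

Lemma measurable_Im : measurable_fun setT (fun z : R[i] => complex.Im z).
Proof. exact: measurableT_comp measurable_snd (@measurable_pair_of_complex R). Qed.

Lemma measurable_normCn n : measurable_fun setT (@normCn R n).
Proof.
(* The square root becomes the power 1/2 of a sum of squares of measurable coordinates. *)
rewrite (_ : @normCn R n = fun z =>
   (\sum_(j < n) (complex.Re (tnth z j) ^+ 2 + complex.Im (tnth z j) ^+ 2)) `^ 2^-1).
  apply: (measurableT_comp (measurable_powR _)).
  apply: measurable_sum => j; apply: measurable_funD; apply: measurable_funX.
    exact: measurableT_comp measurable_Re (measurable_tnth j).
  exact: measurableT_comp measurable_Im (measurable_tnth j).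
apply/funext => z; rewrite -sqr_normCn -powR_mulrn ?normCn_ge0//.
by rewrite -powRrM divff// powRr1// normCn_ge0.
Qed.

Definition cube n (I : interval R) : set (n.-tuple R[i]) :=
  [set z | forall j, complex.Re (tnth z j) \in I /\ complex.Im (tnth z j) \in I].

Lemma measurable_square (I : interval R) :
  measurable [set z : R[i] | complex.Re z \in I /\ complex.Im z \in I].
Proof.
apply: measurableI; rewrite -[X in measurable X]setTI.
- exact: (measurable_Re measurableT (measurable_itv I)).
- exact: (measurable_Im measurableT (measurable_itv I)).
Qed.

Lemma measurable_cube n (I : interval R) : measurable (@cube n I).
Proof.
rewrite (_ : cube I = \bigcap_(j in [set: 'I_n])
    ((@tnth n R[i])^~ j @^-1` [set z | complex.Re z \in I /\ complex.Im z \in I])).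
  apply: fin_bigcap_measurable => // j _; rewrite -[X in measurable X]setTI.
  exact: (measurable_tnth j measurableT (measurable_square I)).
by apply/seteqP; split => z /= + j; [move=> /(_ j)|move=> /(_ j Logic.I)].
Qed.

Lemma lebesgue_cube n (I : interval R) (v : R) :
  lebesgue_measure [set` I] = v%:E ->
  lebesgue_Cn R n (cube I) = (v ^+ (2 * n))%:E.
Proof.
move=> Iv.
rewrite (lebesgue_Cn_box
  (A := fun=> [set z | complex.Re z \in I /\ complex.Im z \in I])).
  rewrite (eq_bigr (fun=> (v ^+ 2)%:E)); last first.
    move=> j _; rewrite (@lebesgue_complex_rect R [set` I] [set` I])//.
    by rewrite [lebesgue_measure _]Iv -EFinM.
  by rewrite prodEFin prodr_const card_ord exprM.
by move=> _; exact: measurable_square.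
Qed.

(** Each of the 2 n real coordinates is at most the norm in absolute value, so the ball lies in the
    cube of side 2 r. *)
Lemma lebesgue_ball_le n (r : R) : 0 <= r ->
  (lebesgue_Cn R n [set z | normCn z <= r]%R <= ((2 * r) ^+ (2 * n))%:E)%E.
Proof.
move=> r0; rewrite -(@lebesgue_cube n `[- r, r]); last first.
  rewrite lebesgue_measure_itv/= lte_fin.
  case: ifPn => [_|]; first by rewrite -EFinB; congr EFin; ring.
  by rewrite -leNgt => ?; congr EFin; lra.
apply: le_measure; rewrite ?inE.
- rewrite -[X in measurable X]setTI.
  exact: (measurable_normCn measurableT (measurable_itv `]-oo, r])).
- exact: measurable_cube.
move=> z /= zr j.
have H : complex.Re (tnth z j) ^+ 2 + complex.Im (tnth z j) ^+ 2 <= r ^+ 2.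
  have : normCn z ^+ 2 <= r ^+ 2 by rewrite ler_pXn2r ?nnegrE ?normCn_ge0.
  apply: le_trans; rewrite sqr_normCn (bigD1 j)//= lerDl sumr_ge0// => i _.
  by rewrite addr_ge0 ?sqr_ge0.
have le_r x : x ^+ 2 <= r ^+ 2 -> x \in `[- r, r].
  by move=> xr; rewrite in_itv/= -ler_norml -(ler_pXn2r (_ : 0 < 2)%N)
    ?nnegrE// real_normK ?num_real.
by split; apply/le_r/(le_trans _ H); rewrite (lerDl, lerDr) sqr_ge0.
Qed.

(* The cube [`]a / s, b / s]^(2 n)] with [s = sqrt (2 n)] lies in the annulus. *)
Lemma lebesgue_annulus_ge n (a b : R) (A : set (n.-tuple R[i])) :
  (0 < n)%N -> 0 <= a < b -> measurable A ->
  [set z | a < normCn z <= b] `<=` A ->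
  (((b - a) ^+ (2 * n) / (2 * n)%:R ^+ n)%:E <= lebesgue_Cn R n A)%E.
Proof.
move=> n0 /andP[a0 ab] mA sA; pose s : R := Num.sqrt (2 * n)%:R.
have s0 : 0 < s by rewrite sqrtr_gt0 ltr0n muln_gt0.
have s2 : s ^+ 2 = (2 * n)%:R by rewrite sqr_sqrtr// ler0n.
rewrite (_ : (b - a) ^+ _ / _ = (b / s - a / s) ^+ (2 * n)); last first.
  by rewrite -mulrBl exprMn exprVn [s ^+ _]exprM s2.
rewrite -(@lebesgue_cube n `]a / s, b / s]); last first.
  by rewrite lebesgue_measure_itv/= lte_fin ltr_pM2r ?invr_gt0// ab -EFinB.
apply: le_measure; rewrite ?inE//; first exact: measurable_cube.
apply: subset_trans sA => z /= zab.
have b0 : 0 < b by rewrite (le_lt_trans a0).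
(* A point whose 2 n real coordinates all equal c / s has norm c, so a and b can be compared with
   the norm coordinatewise. *)
have sq c : 0 <= c -> c ^+ 2 = \sum_(j < n) ((c / s) ^+ 2 + (c / s) ^+ 2).
  move=> c0; rewrite sumr_const card_ord -mulr2n -mulrnA exprMn exprVn s2.
  by rewrite -[RHS]mulr_natr -mulrA mulVf ?mulr1// pnatr_eq0 muln_eq0 -lt0n n0.
have as0 : 0 <= a / s by rewrite divr_ge0// ltW.
have bs0 : 0 <= b / s by rewrite divr_ge0// ltW.
rewrite -(ler_pXn2r (_ : 0 < 2)%N) ?nnegrE ?normCn_ge0// ?(ltW b0)//.
rewrite -(ltr_pXn2r (_ : 0 < 2)%N) ?nnegrE ?normCn_ge0//.
rewrite sqr_normCn (sq a)// (sq b) ?(ltW b0)//; apply/andP; split; last first.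
  apply: ler_sum => j _; have := zab j; rewrite !in_itv/=.
  move=> [/andP[? ?] /andP[? ?]].
  by rewrite lerD// ler_pXn2r ?nnegrE// (le_trans as0)// ltW.
apply: ltr_sum => [|j _].
  by apply/hasP; exists (Ordinal n0); rewrite ?mem_index_enum.
have := zab j; rewrite !in_itv/= => -[/andP[? ?] /andP[? ?]].
by rewrite ltrD// ltr_pXn2r ?nnegrE// (le_trans as0)// ltW.
Qed.

End balls_and_boxes.

(** * Dyadic-type shells in the variable L and their volumes *)

Section shells.
Context {R : realType}.
Variable n : nat.
Implicit Types (r : R) (k : nat) (z : n.-tuple R[i]).

Definition logr r : R := - ln (r ^+ 2).

Definition shell k : set (n.-tuple R[i]) :=
  [set z | logr (normCn z) \in `[k%:R, k.+1%:R[].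

(** The radius r at which [logr r] equals k. *)
Definition radius k : R := expR (- (k%:R / 2)).

Lemma logrE r : 0 < r -> logr r = - (2 * ln r).
Proof. by move=> r0; rewrite /logr lnXn// mulr_natl. Qed.

Lemma logr_ge r k : 0 < r -> (k%:R <= logr r) = (r <= radius k).
Proof.
move=> r0; rewrite -[in RHS](@lnK _ r) ?posrE// ler_expR logrE//.
by apply/idP/idP; lra.
Qed.

Lemma shellE k z : 0 < normCn z ->
  shell k z = (radius k.+1 < normCn z <= radius k) :> Prop.
Proof.
move=> z0; rewrite /shell/= in_itv/= logr_ge// ltNge logr_ge// -ltNge.
by rewrite andbC.
Qed.

Lemma radius_gt0 k : 0 < radius k.
Proof. exact: expR_gt0. Qed.

Lemma radius_le (k m : nat) : (k <= m)%N -> radius m <= radius k.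
Proof. by move=> km; rewrite ler_expR lerN2 ler_pM2r// ler_nat. Qed.

Lemma radius_exp k m : radius k ^+ (2 * m) = expR (- (k%:R * m%:R)).
Proof. by rewrite -expRM_natl; congr expR; rewrite natrM; field. Qed.

Lemma radiusS k : radius k.+1 = radius k * expR (- 2^-1).
Proof. by rewrite -expRD; congr expR; rewrite -natr1; field. Qed.

Lemma measurable_logr : measurable_fun setT (logr \o @normCn R n).
Proof.
apply: (@measurable_funN _ _ _ setT (fun z => ln (normCn z ^+ 2))).
apply: measurableT_comp => //; apply: measurable_funX; exact: measurable_normCn.
Qed.

Lemma measurable_shell k : measurable (shell k).
Proof.
rewrite -[X in measurable X]setTI.
exact: (measurable_logr measurableT (measurable_itv `[k%:R, k.+1%:R[)).
Qed.

(** The index of a shell is the integer part of L at any of its points. *)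
Lemma trivIset_shell : trivIset setT shell.
Proof.
have truncL k z : shell k z -> Num.trunc (logr (normCn z)) = k.
  by rewrite /shell/= in_itv/=; exact: truncn_def.
by move=> i j _ _ [z [/truncL <- /truncL <-]].
Qed.

(* Fails for [k = 0], since [ln 0 = 0] puts the origin in [shell 0]. *)
Lemma shell_normCn_gt0 k z : (0 < k)%N -> shell k z -> 0 < normCn z.
Proof.
move=> k0; rewrite lt_def normCn_ge0 andbT /shell/= in_itv/= => /andP[+ _].
apply: contraTneq => ->; rewrite /logr expr0n/= ln0// oppr0 -ltNge ltr0n//.
Qed.

Lemma lebesgue_shell_le k : (0 < k)%N ->
  (lebesgue_Cn R n (shell k) <= (4 ^+ n * expR (- (k%:R * n%:R)))%:E)%E.
Proof.
move=> k0.
rewrite (_ : 4 ^+ n * _ = (2 * radius k) ^+ (2 * n)); last first.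
  rewrite exprMn radius_exp exprM; congr (_ ^+ _ * _); ring.
apply: le_trans (lebesgue_ball_le n (ltW (radius_gt0 k))).
apply: le_measure; rewrite ?inE; first exact: measurable_shell.
  rewrite -[X in measurable X]setTI.
  exact: (measurable_normCn measurableT (measurable_itv `]-oo, radius k])).
move=> z kz /=; have z0 := shell_normCn_gt0 k0 kz.
by move: kz; rewrite shellE// => /andP[].
Qed.

(** The ratio of inner to outer radius is e^(- 1/2) for every k, so the annulus bound is a fixed
    multiple of [radius k ^+ (2 * n)]. *)
Lemma lebesgue_shell_ge : (0 < n)%N -> exists2 c : R, 0 < c &
  forall k, ((c * expR (- (k%:R * n%:R)))%:E <= lebesgue_Cn R n (shell k))%E.
Proof.
move=> n0; have e1 : 0 < 1 - expR (- 2^-1) :> R.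
  by rewrite subr_gt0 -expR0 ltr_expR oppr_lt0 invr_gt0.
exists ((1 - expR (- 2^-1)) ^+ (2 * n) / (2 * n)%:R ^+ n) => [|k].
  by rewrite divr_gt0 ?exprn_gt0// ltr0n muln_gt0.
rewrite -radius_exp mulrAC -exprMn mulrBl mul1r mulrC.
rewrite [X in _ - X]mulrC -radiusS mulrC.
apply: lebesgue_annulus_ge => //; last 2 first.
- exact: measurable_shell.
- move=> z /= zk; rewrite shellE//.
  by case/andP: zk => + _; exact/lt_trans/radius_gt0.
- rewrite (ltW (radius_gt0 _))/= radiusS -subr_gt0 -{1}[radius k]mulr1 -mulrBr.
  by rewrite mulr_gt0// radius_gt0.
Qed.

End shells.

(** * Integrals of functions with constant bounds *)

Section integral_bounds.
Context d (T : measurableType d) (R : realType).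
Variables (mu : {measure set T -> \bar R}) (D : set T) (f : T -> R) (M v : R).
Hypotheses (mD : measurable D) (mf : measurable_fun D (EFin \o f)).
Hypothesis (M0 : 0 <= M).

Lemma integral_le_cst : (forall x, D x -> 0 <= f x <= M) ->
  (mu D <= v%:E)%E -> (\int[mu]_(x in D) (f x)%:E <= (M * v)%:E)%E.
Proof.
move=> fM Dv; apply: (@le_trans _ _ (\int[mu]_(x in D) (cst M%:E x)))%E.
  apply: ge0_le_integral => //.
  - by move=> x /fM /andP[? _]; rewrite lee_fin.
  - by move=> x /fM /andP[_ ?]; rewrite lee_fin.
by rewrite integral_cst// EFinM lee_pmul// lee_fin.
Qed.

Lemma integral_ge_cst : (forall x, D x -> M <= f x) ->
  (v%:E <= mu D)%E -> ((M * v)%:E <= \int[mu]_(x in D) (f x)%:E)%E.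
Proof.
move=> fM Dv; apply: (@le_trans _ _ (\int[mu]_(x in D) (cst M%:E x)))%E.
  by rewrite integral_cst// EFinM lee_wpmul2l// lee_fin.
apply: ge0_le_integral => //.
Qed.

End integral_bounds.

(** * Convergence and divergence of the integral, summed over shells *)

Section integrability.
Context {R : realType}.
Variables (n : nat) (alpha gamma p : R).
Hypothesis n0 : (0 < n)%N.
Implicit Types (k : nat) (z : n.-tuple R[i]).

Let mu := lebesgue_Cn R n.
Let f z := `|u_fun alpha gamma z| `^ p.
Let b := alpha * p - n%:R.
Let t := gamma * p.

Let f_ge0 z : 0 <= f z.
Proof. exact: powR_ge0. Qed.

Let measurable_f : measurable_fun setT (EFin \o f).
Proof.
apply/measurable_EFinP; apply: (measurableT_comp (measurable_powR _)).
apply: measurableT_comp => //; apply: measurable_funN; apply: measurable_funM.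
  exact: measurableT_comp (measurable_powR _) (@measurable_normCn R n).
exact: measurableT_comp (measurable_powR _) (@measurable_logr R n).
Qed.

(** The factor e^(n L) is split off because it cancels the volume e^(- n k) of the shell up to
    constants; the rest is g(L), with exponents [b] and [t]. *)
Let fE z : 0 < normCn z -> let L := logr (normCn z) in
  f z = expR (n%:R * L) * (expR (b * L) * L `^ (- t)).
Proof.
move=> z0 L; rewrite /f /u_fun -/(logr _) -/L normrN ger0_norm; last first.
  by rewrite mulr_ge0// powR_ge0.
rewrite powRM ?powR_ge0// -!powRrM mulrA -expRD; congr (_ * _); last first.
  by rewrite /t mulNr.
by rewrite /powR gt_eqF// /L logrE//; congr expR; rewrite /b; ring.
Qed.

Let ball r : set (n.-tuple R[i]) := [set z | normCn z < r].

Let measurable_ball r : measurable (ball r).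
Proof.
rewrite -[X in measurable X]setTI.
exact: (measurable_normCn measurableT (measurable_itv `]-oo, r[)).
Qed.

Let measurable_ball_shell r k : measurable (ball r `&` shell k).
Proof. by apply: measurableI => //; exact: measurable_shell. Qed.

Let integral_ball_shells r :
  (\int[mu]_(z in ball r `&` \bigcup_k shell k) (f z)%:E =
   \sum_(0 <= k <oo) \int[mu]_(z in ball r `&` shell k) (f z)%:E)%E.
Proof.
rewrite setI_bigcupr ge0_integral_bigcup//.
- exact: measurable_funTS.
- by move=> z _; rewrite lee_fin.
- by apply: trivIset_setIl; exact: trivIset_shell.
Qed.

Let integrable_f :
  Lp_loc0 p (@u_fun R n alpha gamma) <->
  exists2 eps, 0 < eps & (\int[mu]_(z in ball eps) (f z)%:E < +oo)%E.
Proof.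
have H eps : mu.-integrable (ball eps) (EFin \o f) <->
    (\int[mu]_(z in ball eps) (f z)%:E < +oo)%E.
  have E : (\int[mu]_(z in ball eps) `|(EFin \o f) z| =
      \int[mu]_(z in ball eps) (f z)%:E)%E.
    by apply: eq_integral => z _; rewrite /= ger0_norm.
  split=> [/integrableP[_]|foo]; first by rewrite E.
  by apply/integrableP; split; [exact: measurable_funTS|rewrite E].
by split=> -[eps e0] /H ?; exists eps.
Qed.

Lemma Lp_loc0_u_fun : b < 0 \/ (b = 0 /\ 1 < t) ->
  Lp_loc0 p (@u_fun R n alpha gamma).
Proof.
move=> /expR_powR_le_powR[s [C [s1 C0 HC]]].
have [M HM] := sum_powR_bounded s1.
have s0 : 0 < s by rewrite (lt_trans _ s1).
(* [C] comes from g, 4^n from the shell volume, and e^n from the variation of e^(n L) over a shell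
   of unit width in L. *)
pose K : R := expR n%:R * C * 4 ^+ n.
have K0 : 0 <= K by rewrite !mulr_ge0 ?expR_ge0 ?ltW ?exprn_ge0.
(* Inside this radius L > 1 off the origin, which is the range where the bound on g applies. *)
apply/integrable_f; exists (radius 1); first exact: radius_gt0.
have -> : ball (radius 1) = ball (radius 1) `&` \bigcup_k shell k.
  rewrite setIidl// => z zr; exists (Num.trunc (logr (normCn z))) => //.
  rewrite /shell/= in_itv/= truncn_itv//.
  (* The integer part of L locates the shell once L >= 0; at the origin L = 0 by the default value
     of [ln 0]. *)
  have [z0|] := ltP 0 (normCn z); last first.
    rewrite le_eqVlt ltNge normCn_ge0 orbF => /eqP ->.
    by rewrite /logr expr0n/= ln0// oppr0.
  by rewrite (logr_ge 0)// (le_trans (ltW zr))// radius_le.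
rewrite integral_ball_shells.
have term k : (\int[mu]_(z in ball (radius 1) `&` shell k) (f z)%:E <=
    (K * k%:R `^ (- s))%:E)%E.
  have mf : measurable_fun (ball (radius 1) `&` shell k) (EFin \o f).
    exact: measurable_funTS.
  case: k mf => [|k] mf.
    (* [0 `^ (- s) = 0], and [ball (radius 1)] meets [shell 0] only at 0. *)
    rewrite powR0 ?mulr0 ?oppr_eq0 ?gt_eqF// null_set_integral//.
    apply/eqP; rewrite eq_le measure_ge0 andbT.
    have := @lebesgue_ball_le R n 0 (lexx _).
    rewrite mulr0 expr0n muln_eq0/= gtn_eqF//; apply: le_trans.
    apply: le_measure; rewrite ?inE//.
      rewrite -[X in measurable X]setTI.
      exact: (measurable_normCn measurableT (measurable_itv `]-oo, 0])).
    move=> z [/= zr z0]; rewrite leNgt; apply/negP => zp.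
    by move: z0; rewrite shellE// ltNge (ltW zr).
  (* On this shell L < k + 2 bounds e^(n L) and L >= k + 1 bounds L^(- s); the last factor bounds
     the volume. *)
  have -> : K * k.+1%:R `^ (- s) =
      (expR (n%:R * k.+2%:R) * (C * k.+1%:R `^ (- s))) *
      (4 ^+ n * expR (- (k.+1%:R * n%:R))).
    have -> : expR (n%:R * k.+2%:R) = expR n%:R * expR (k.+1%:R * n%:R) :> R.
      by rewrite -expRD; congr expR; rewrite -[k.+2%:R]natr1; ring.
    by rewrite expRN /K; field; rewrite gt_eqF// expR_gt0.
  apply: integral_le_cst => //.
  - by rewrite !mulr_ge0 ?expR_ge0 ?powR_ge0// ltW.
  - move=> z [_ zk]; rewrite f_ge0/= fE ?(shell_normCn_gt0 _ zk)//.
    move: zk; rewrite /shell/= in_itv/= => /andP[kL Lk].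
    have L1 : 1 <= logr (normCn z) by rewrite (le_trans _ kL)// ler1n.
    rewrite ler_pM ?expR_ge0 ?mulr_ge0 ?powR_ge0 ?expR_ge0//.
      by rewrite ler_expR ler_wpM2l// ltW.
    rewrite (le_trans (HC _ L1))// ler_pM2l// !powRN.
    rewrite lef_pV2 ?posrE ?powR_gt0 ?(lt_le_trans ltr01 L1)//.
    by rewrite ge0_ler_powR ?nnegrE ?(ltW s0)// (le_trans ler01).
  - apply: le_trans (lebesgue_shell_le n (ltn0Sn k)).
    by apply: le_measure; rewrite ?inE//; exact: measurable_shell.
apply: (@le_lt_trans _ _ (K * M)%:E); last exact: ltry.
apply: lime_le.
  by apply: is_cvg_nneseries => k _ _; apply: integral_ge0 => z _; rewrite lee_fin.
apply: nearW => N.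
apply: (@le_trans _ _ (\sum_(0 <= k < N) (K * k%:R `^ (- s))%:E)%E).
  exact: lee_sum.
by rewrite sumEFin lee_fin -mulr_sumr ler_wpM2l.
Qed.

Lemma not_Lp_loc0_u_fun : 0 < b \/ (b = 0 /\ t <= 1) ->
  ~ Lp_loc0 p (@u_fun R n alpha gamma).
Proof.
move=> /expR_powR_ge_inv[c c0 Hc] /integrable_f[eps e0].
have [c' c'0 Hc'] := @lebesgue_shell_ge R n n0.
(* From [k0] on, the shells lie inside the ball of radius [eps]; the successor also makes [k0]
   positive, which keeps them away from the origin. *)
pose k0 := (Num.trunc (logr eps)).+1.
have k0eps : radius k0 < eps by rewrite ltNge -logr_ge// -ltNge truncnS_gt.
pose K := c * c'; have K0 : 0 < K by rewrite mulr_gt0.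
have term k : (k0 <= k)%N -> ((K * k.+1%:R^-1)%:E <=
    \int[mu]_(z in ball eps `&` shell k) (f z)%:E)%E.
  move=> k0k; have k1 : (0 < k)%N by rewrite (leq_trans _ k0k).
  have -> : ball eps `&` shell k = shell k.
    apply: setIidr => z zk; have z0 := shell_normCn_gt0 k1 zk.
    move: zk; rewrite shellE// => /andP[_ zk].
    by rewrite /ball/= (le_lt_trans zk)// (le_lt_trans _ k0eps)// radius_le.
  (* Here L >= k bounds e^(n L) from below and L < k + 1 bounds c / L from below; the exponentials
     then cancel. *)
  have -> : K * k.+1%:R^-1 = (expR (n%:R * k%:R) * (c / k.+1%:R)) *
      (c' * expR (- (k%:R * n%:R))).
    rewrite expRN [k%:R * _]mulrC /K; field.
    by rewrite gt_eqF ?expR_gt0//= nat1r pnatr_eq0.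
  apply: integral_ge_cst => //.
  - exact: measurable_shell.
  - exact: measurable_funTS.
  - by rewrite mulr_ge0 ?expR_ge0// divr_ge0// ltW.
  - move=> z zk; rewrite fE ?(shell_normCn_gt0 _ zk)//.
    move: zk; rewrite /shell/= in_itv/= => /andP[kL Lk].
    have L1 : 1 <= logr (normCn z) by rewrite (le_trans _ kL)// ler1n.
    rewrite ler_pM ?expR_ge0 ?divr_ge0 ?(ltW c0)//.
      by rewrite ler_expR ler_wpM2l.
    apply: le_trans (Hc _ L1); rewrite ler_pM2l// lef_pV2 ?posrE// ?ltW//.
    by rewrite (lt_le_trans ltr01).
apply/negP; rewrite -leNgt leye_eq; apply/eqP/eq_infty => M.
have [N HN] := @sum_harmonic_unbounded R k0 (M / K).
apply: (@le_trans _ _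
  (\int[mu]_(z in ball eps `&` \bigcup_k shell k) (f z)%:E)%E); last first.
  apply: ge0_subset_integral => //.
  - by rewrite setI_bigcupr; exact: bigcupT_measurable.
  - exact: measurable_funTS.
  - by move=> z _; rewrite lee_fin.
rewrite integral_ball_shells.
(* The maximum keeps the cut at [k0] within the range of summation even when N < [k0]. *)
apply: (@le_trans _ _ (\sum_(0 <= k < maxn k0 N)
    \int[mu]_(z in ball eps `&` shell k) (f z)%:E)%E); last first.
  by apply: nneseries_lim_ge => k _ _; apply: integral_ge0 => z _; rewrite lee_fin.
rewrite (@big_cat_nat _ _ _ k0)//= ?leq_maxl//.
apply: (@le_trans _ _ (\sum_(k0 <= k < maxn k0 N) (K * k.+1%:R^-1)%:E)%E).
  rewrite sumEFin lee_fin -mulr_sumr mulrC -ler_pdivrMr//.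
  apply: (le_trans (ltW HN)).
  have [Nk|kN] := leqP N k0; first by rewrite big_geq ?sumr_ge0.
  by rewrite lexx.
apply: (@le_trans _ _ (\sum_(k0 <= k < maxn k0 N)
    \int[mu]_(z in ball eps `&` shell k) (f z)%:E)%E); last first.
  by rewrite leeDr// sume_ge0// => k _; apply: integral_ge0 => z _; rewrite lee_fin.
rewrite big_nat_cond [leRHS]big_nat_cond; apply: lee_sum => k.
by rewrite andbT => /andP[+ _]; exact: term.
Qed.

End integrability.

(** * Case distinction on the sign of alpha p - n *)

Theorem proposition3p2 (R : realType) (n : nat) (alpha gamma p : R)
    (hn : (2 <= n)%N) (hp : 0 < p) :
  (0 < alpha ->
     (Lp_loc0 p (@u_fun R n alpha gamma) <->
      (p < n%:R / alpha \/ (p = n%:R / alpha /\ 1 < gamma * p)))) /\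
  (alpha <= 0 -> Lp_loc0 p (@u_fun R n alpha gamma)).
Proof.
have n0 : (0 < n)%N by exact: leq_trans hn.
split=> a0; last first.
  apply: Lp_loc0_u_fun => //; left.
  by rewrite subr_lt0 (@le_lt_trans _ _ 0) ?ltr0n// mulr_le0_ge0// ltW.
have ltE : (p < n%:R / alpha) = (alpha * p - n%:R < 0).
  by rewrite ltr_pdivlMr// mulrC subr_lt0.
have an0 : alpha != 0 by rewrite gt_eqF.
have eqE : p = n%:R / alpha <-> alpha * p - n%:R = 0.
  split=> [->|/subr0_eq <-]; first by rewrite mulrC divfK ?subrr.
  by rewrite mulrAC divff ?mul1r.
rewrite ltE; split=> [H|[lt0|[/eqE eq0 t1]]].
(* For necessity, the sign of alpha p - n and the size of gamma p leave only cases that are either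
   claimed or excluded by divergence. *)
- have [lt0|gt0|eq0] := ltrgtP (alpha * p - n%:R) 0; first by left.
    by have := not_Lp_loc0_u_fun n0 (or_introl gt0) H.
  right; split; first exact/eqE.
  rewrite ltNge; apply/negP => t1.
  exact: not_Lp_loc0_u_fun n0 (or_intror (conj eq0 t1)) H.
- by apply: Lp_loc0_u_fun => //; left.
- by apply: Lp_loc0_u_fun => //; right.
Qed.
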